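(* Let $\alpha_1,\alpha_2\in[0,\pi/2)$, let $X\in\mathbb{M}^s_{n,\alpha_1}$ and $Y\in\mathbb{M}^s_{n,\alpha_2}$. Then $$\omega(X\circ Y)\le\sec(\alpha_1)\sec(\alpha_2)\,\omega(X)\,\omega(Y).$$
   Context: $\mathbb{M}_n$ is the algebra of all $n\times n$ complex matrices. For $X=[x_{ij}],Y=[y_{ij}]\in\mathbb{M}_n$ the Hadamard product is $X\circ Y=[x_{ij}y_{ij}]$. The numerical range of $X\in\mathbb{M}_n$ is $W(X)=\{\langle Xx,x\rangle : x\in\mathbb{C}^n,\ \|x\|=1\}$, with the standard inner product and Euclidean norm on $\mathbb{C}^n$, and the numerical radius is $\omega(X)=\sup\{|z| : z\in W(X)\}$. For $\alpha\in[0,\pi/2)$ let $S_\alpha=\{z\in\mathbb{C} : \operatorname{Re}(z)>0,\ |\operatorname{Im}(z)|\le\tan(\alpha)\operatorname{Re}(z)\}$, and let $\mathbb{M}^s_{n,\alpha}$ be the class of all $X\in\mathbb{M}_n$ such that $W(zX)\subset S_\alpha$ for some $z\in\mathbb{C}$ with $|z|=1$. *)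

(* Defs.v *)
From mathcomp Require Export all_boot all_order all_algebra.
From mathcomp Require Export complex.
From mathcomp Require Export all_classical all_reals all_analysis.

Set Implicit Arguments.
Unset Strict Implicit.
Unset Printing Implicit Defensive.

Import Order.TTheory GRing.Theory Num.Theory.

Local Open Scope classical_set_scope.
Local Open Scope ring_scope.

(* [ComplexField.Normc.normc : R[i] -> R] is the real-valued modulus; the norm
   [`|z|] of the numDomainType [R[i]] takes its values in [R[i]]. *)
Notation cmod := ComplexField.Normc.normc.

Definition hadamard (R : realType) (n : nat) (X Y : 'M[R[i]]_n) : 'M[R[i]]_n :=
  map2_mx *%R X Y.

(* [dotmx] is linear in its first argument and conjugate-linear in the second;
   it is defined on row vectors, hence the transpositions. *)
Definition cdot (R : realType) (n : nat) (u v : 'cV[R[i]]_n) : R[i] :=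
  dotmx u^T v^T.

Definition cnorm (R : realType) (n : nat) (u : 'cV[R[i]]_n) : R[i] :=
  sqrtC (cdot u u).

Definition numerical_range (R : realType) (n : nat) (X : 'M[R[i]]_n) :
    set R[i] :=
  [set cdot (X *m x) x | x in [set x : 'cV[R[i]]_n | cnorm x = 1]].

(* The set of moduli is bounded, and nonempty as soon as [0 < n], so that
   [sup] is then the genuine least upper bound. *)
Definition numerical_radius (R : realType) (n : nat) (X : 'M[R[i]]_n) : R :=
  sup [set cmod z | z in numerical_range X].

Definition sector (R : realType) (alpha : R) : set R[i] :=
  [set z : R[i] | 0 < complex.Re z /\ `|complex.Im z| <= tan alpha * complex.Re z].

Definition sectorial (R : realType) (n : nat) (alpha : R) :
    set 'M[R[i]]_n :=
  [set X | exists2 z : R[i],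
    cmod z = 1 & numerical_range (z *: X) `<=` sector alpha].
Arguments sectorial {R n} alpha.

Definition sec (R : realType) (x : R) : R := (cos x)^-1.

(* Main.v *)
Require Import Defs.
From mathcomp Require Import ring.

(** After rotation, [X = A + 'i B] with [|B| <= t A] as quadratic forms, where
    [t = tan alpha1]. Hence [X = (1 + 'i t) P + (1 - 'i t) Q] with
    [P, Q = (A +- B / t) / 2] positive semidefinite and [P + Q = A]; likewise
    [Y = (1 + 'i s) P' + (1 - 'i s) Q'] with [P' + Q' = C] and
    [s = tan alpha2]. Expand the Hadamard product of [X] and [Y] into four
    terms: all coefficients have modulus [|1 + 'i t| |1 + 'i s|], the product
    of the two secants, and all four matrices are positive semidefinite by the
    Schur product theorem. So the form of the product is bounded by the secants
    times the form of the Hadamard product of [A] and [C]. Finally [C <= w(C) I]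
    bounds the latter by [w(C)] times the diagonal of [A], hence by
    [w(A) w(C)], and [w(A) <= w(X)], [w(C) <= w(Y)]. *)

Import Order.TTheory GRing.Theory Num.Theory.

Local Open Scope classical_set_scope.
Local Open Scope sesquilinear_scope.
Local Open Scope ring_scope.

(** * Quadratic forms and positive semidefinite matrices *)

Section QuadraticForm.
Set Implicit Arguments.
Unset Strict Implicit.
Variables (C : numClosedFieldType) (n : nat).
Implicit Types (A B P Q X Y : 'M[C]_n) (u v : 'I_n -> C).

Definition quad X u : C := \sum_i \sum_j X i j * u j * (u i)^*.

Definition sqnorm u : C := \sum_i u i * (u i)^*.

Definition psd A : Prop :=
  (forall i j, A j i = (A i j)^*) /\ (forall u, 0 <= quad A u).

Definition schur_mx X Y : 'M[C]_n := map2_mx *%R X Y.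

Lemma quadD X Y u : quad (X + Y) u = quad X u + quad Y u.
Proof.
rewrite /quad -big_split; apply: eq_bigr => i _; rewrite -big_split.
by apply: eq_bigr => j _; rewrite !mxE !mulrDl.
Qed.

Lemma quadZ c X u : quad (c *: X) u = c * quad X u.
Proof.
rewrite /quad big_distrr /=; apply: eq_bigr => i _; rewrite big_distrr /=.
by apply: eq_bigr => j _; rewrite !mxE !mulrA.
Qed.

Lemma quad_adjoint X u : quad (X ^t*) u = (quad X u)^*.
Proof.
rewrite /quad exchange_big rmorph_sum; apply: eq_bigr => i _.
rewrite rmorph_sum; apply: eq_bigr => j _.
by rewrite !mxE !rmorphM /= conjCK mulrAC.
Qed.

Lemma quad_scale X (c : C) u : quad X (fun i => c * u i) = c * c^* * quad X u.
Proof.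
rewrite /quad big_distrr /=; apply: eq_bigr => i _; rewrite big_distrr /=.
by apply: eq_bigr => j _; rewrite rmorphM /=; ring.
Qed.

Lemma quad_delta X i : quad X (fun k => (k == i)%:R) = X i i.
Proof.
rewrite /quad (bigD1 i) //= [X in _ + X]big1 ?addr0; last first.
  by move=> k /negbTE ki; apply: big1 => j _; rewrite ki conjC0 mulr0.
rewrite (bigD1 i) //= [X in _ + X]big1 ?addr0; last first.
  by move=> k /negbTE ki; rewrite ki mulr0 mul0r.
by rewrite eqxx conjC1 !mulr1.
Qed.

Lemma sqnorm_ge0 u : 0 <= sqnorm u.
Proof. by apply: sumr_ge0 => i _; apply: mul_conjC_ge0. Qed.

Lemma sqnorm_eq0 u : sqnorm u = 0 -> forall i, u i = 0.
Proof.
move=> /eqP; rewrite psumr_eq0 => [/allP /= h i|i _]; last exact: mul_conjC_ge0.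
by have := h i (mem_index_enum _); rewrite mul_conjC_eq0 => /eqP.
Qed.

Lemma sqnorm_delta (i : 'I_n) : sqnorm (fun k => (k == i)%:R) = 1.
Proof.
rewrite /sqnorm (bigD1 i) //= big1 ?eqxx ?conjC1 ?mulr1 ?addr0 // => k /negbTE ->.
by rewrite mul0r.
Qed.

(** Homogeneity carries facts about unit vectors over to all vectors. If [u] vanishes, both sides
    are zero and the basis vector at [i0] serves. *)
Lemma unit_rescaling (i0 : 'I_n) u :
  exists2 v, sqnorm v = 1 & forall X, quad X u = sqnorm u * quad X v.
Proof.
have [N0|N0] := eqVneq (sqnorm u) 0.
  exists (fun k => (k == i0)%:R); first exact: sqnorm_delta.
  move=> X; rewrite N0 mul0r /quad; apply: big1 => i _; apply: big1 => j _.
  by rewrite (sqnorm_eq0 N0 i) conjC0 mulr0.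
set c := sqrtC (sqnorm u).
have c_ge0 : 0 <= c by rewrite sqrtC_ge0 sqnorm_ge0.
have cVJ : (c^-1)^* = c^-1 by apply/CrealP; rewrite rpredV ger0_real.
have cc : c * c = sqnorm u by rewrite -expr2 sqrtCK.
have c0 : c != 0 by rewrite sqrtC_eq0.
exists (fun i => c^-1 * u i) => [|X].
  rewrite -(mulVf N0) -{1}cc invfM /sqnorm big_distrr /=.
  by apply: eq_bigr => i _; rewrite rmorphM /= cVJ; ring.
by rewrite quad_scale cVJ mulrA -invfM cc divff ?mul1r.
Qed.

(** Spectral theorem: [A] is [P^* D P] with [P] unitary and [D] diagonal, and [V] is [P^*] times the
    square root of [D]. *)
Lemma psd_gram A : psd A ->
  exists V : 'M[C]_n, forall i j, A i j = \sum_k V i k * (V j k)^*.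
Proof.
move=> [Ah Age].
have Aherm : A \is hermsymmx.
  apply/is_hermitianmxP; rewrite expr0 scale1r; apply/matrixP => i j.
  by rewrite !mxE -Ah.
have /hermitian_normalmx/orthomx_spectralP := Aherm.
set P := spectralmx A; set d := spectral_diag A.
have Pu : P \is unitarymx by exact: spectral_unitarymx.
rewrite invmx_unitary // => AE.
have AEij i j : A i j = \sum_k (P k i)^* * d 0 k * P k j.
  rewrite {1}AE mul_mx_diag mxE; apply: eq_bigr => k _.
  by rewrite !mxE.
have d_ge0 k : 0 <= d 0 k.
  (* An eigenvalue is the value of the form at its eigenvector, the conjugate of row [k] of [P]. *)
  have -> : d 0 k = quad A (fun i => (P k i)^*).
    have : (P *m A *m (P ^t*)) k k = d 0 k.
      have /unitarymxP PP := Pu.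
      by rewrite AE !mulmxA PP mul1mx -mulmxA PP mulmx1 mxE eqxx.
    move=> <-; rewrite mxE /quad exchange_big; apply: eq_bigr => j _.
    rewrite !mxE big_distrl /=; apply: eq_bigr => i _ /=.
    by rewrite conjCK; ring.
  exact: Age.
exists (\matrix_(i, k) (sqrtC (d 0 k) * (P k i)^*)) => i j.
rewrite AEij; apply: eq_bigr => k _; rewrite !mxE rmorphM /= conjCK.
have -> : (sqrtC (d 0 k))^* = sqrtC (d 0 k).
  by apply/CrealP/ger0_real; rewrite sqrtC_ge0.
by rewrite -{1}[d 0 k]sqrtCK; ring.
Qed.

(** Schur product theorem: the Gram factorization of [A] splits the form into a sum of values of the
    form of [B], at [u] multiplied entrywise by the conjugated columns of [V]. *)
Lemma quad_schur_ge0 A B u : psd A -> (forall v, 0 <= quad B v) ->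
  0 <= quad (schur_mx A B) u.
Proof.
move=> /psd_gram[V AE] Bge.
have -> : quad (schur_mx A B) u = \sum_k quad B (fun j => (V j k)^* * u j).
  rewrite /quad [RHS]exchange_big; apply: eq_bigr => i _.
  rewrite [RHS]exchange_big; apply: eq_bigr => j _.
  rewrite mxE AE !big_distrl /=; apply: eq_bigr => k _ /=.
  by rewrite rmorphM /= conjCK; ring.
exact: sumr_ge0.
Qed.

(** A diagonal entry of [A] is the squared norm of a row of its Gram factor, so all these rows
    vanish. *)
Lemma psd_eq0 A : psd A -> (forall u, quad A u = 0) -> A = 0.
Proof.
move=> /psd_gram[V AE] A0.
have V0 i k : V i k = 0.
  have : sqnorm (V i) = 0 by rewrite /sqnorm -AE -quad_delta A0.
  by move=> /sqnorm_eq0.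
apply/matrixP => i j; rewrite AE mxE; apply: big1 => k _.
by rewrite V0 mul0r.
Qed.

Lemma psdD A B : psd A -> psd B -> psd (A + B).
Proof.
move=> [Ah A0] [Bh B0]; split=> [i j|u]; first by rewrite !mxE Ah Bh rmorphD.
by rewrite quadD addr_ge0.
Qed.

(** The Schur product of [A] with [b I - B] has a nonnegative form, which bounds the form of the
    product by [b] times that of the diagonal of [A]. Basis vectors show that the diagonal entries
    are at most [a]. *)
Lemma quad_schur_le A B (a b : C) u : psd A -> 0 <= b ->
  (forall v, quad A v <= a * sqnorm v) ->
  (forall v, quad B v <= b * sqnorm v) ->
  quad (schur_mx A B) u <= a * b * sqnorm u.
Proof.
move=> psdA b0 Aa Bb.
have quad_scalar (c : 'I_n -> C) :
    quad (\matrix_(i, j) (c i *+ (i == j))) u = \sum_i c i * (u i * (u i)^*).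
  apply: eq_bigr => i _; rewrite (bigD1 i) //= big1 => [|j /negbTE ji].
    by rewrite mxE eqxx addr0 mulrA.
  by rewrite mxE eq_sym ji !mul0r.
have bB v : 0 <= quad (b%:M + (-1) *: B) v.
  have -> : quad (b%:M + -1 *: B) v = b * sqnorm v - quad B v.
    rewrite quadD quadZ mulN1r; congr (_ - _).
    rewrite /sqnorm big_distrr; apply: eq_bigr => i _ /=.
    rewrite (bigD1 i) //= big1 => [|j /negbTE ji].
      by rewrite mxE eqxx addr0 mulrA.
    by rewrite mxE eq_sym ji !mul0r.
  by rewrite subr_ge0.
have := quad_schur_ge0 u psdA bB.
have -> : schur_mx A (b%:M + -1 *: B)
    = (\matrix_(i, j) (A i i * b *+ (i == j))) + (-1) *: schur_mx A B.
  apply/matrixP => i j; rewrite !mxE.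
  by case: eqVneq => [->|_]; rewrite ?mulr1n ?mulr0n; ring.
rewrite quadD quadZ mulN1r subr_ge0 quad_scalar => /le_trans; apply.
rewrite /sqnorm big_distrr; apply: ler_sum => i _ /=.
rewrite ler_wpM2r ?mul_conjC_ge0 // ler_wpM2r //.
rewrite -[leRHS]mulr1 -(sqnorm_delta i) -quad_delta.
exact: Aa.
Qed.

(** * Forms with values in a sector *)

Definition quad_in_sector (t : C) X : Prop := forall u,
  0 <= 'Re (quad X u) /\ `|'Im (quad X u)| <= t * 'Re (quad X u).

(* For [t = 0] the witnesses below are both [A / 2], as [0^-1 = 0], and the
   skew part [B] vanishes. *)
Lemma sector_decomposition (t : C) X : 0 <= t -> quad_in_sector t X ->
  exists P Q, [/\ psd P, psd Q & X = (1 + 'i * t) *: P + (1 - 'i * t) *: Q].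
Proof.
move=> t_ge0 Xt.
pose A := 2^-1 *: (X + X ^t*); pose B := ('i / 2) *: (X ^t* - X).
have quadA u : quad A u = 'Re (quad X u).
  by rewrite quadZ quadD quad_adjoint ReE mulrC.
have quadB u : quad B u = 'Im (quad X u).
  by rewrite quadZ quadD -scaleN1r quadZ quad_adjoint ImE; ring.
have half_real : (2^-1 : C)^* = 2^-1 by apply/CrealP; rewrite rpredV realn.
have hermA i j : A j i = (A i j)^*.
  by rewrite !mxE rmorphM rmorphD /= conjCK half_real; ring.
have hermB i j : B j i = (B i j)^*.
  by rewrite !mxE !rmorphM rmorphB /= conjCK half_real conjCi; ring.
(* Stated for a general real [e] to cover both witnesses, with [e] equal to [t^-1] and to
   [- t^-1]. *)
have half_psd e : e^* = e ->
    (forall u, `|e * 'Im (quad X u)| <= 'Re (quad X u)) ->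
      psd (2^-1 *: (A + e *: B)).
  move=> e_real eX; split=> [i j|u].
    have entry k l : (2^-1 *: (A + e *: B)) k l = 2^-1 * (A k l + e * B k l).
      by rewrite 3!mxE; congr (_ * (_ + _)); rewrite mxE.
    by rewrite !entry rmorphM rmorphD rmorphM /= half_real e_real -hermA -hermB.
  rewrite quadZ quadD quadZ quadA quadB mulr_ge0 ?invr_ge0 ?ler0n //.
  have eR : e * 'Im (quad X u) \is Num.real.
    by rewrite rpredM ?Creal_Im //; apply/CrealP.
  have := eX u; rewrite real_ler_norml // => /andP[+ _].
  by rewrite -subr_ge0 opprK addrC.
have tVJ : (t^-1)^* = t^-1 by apply/CrealP; rewrite rpredV ger0_real.
have tV_bound u : `|t^-1 * 'Im (quad X u)| <= 'Re (quad X u).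
  have [Re0] := Xt u; rewrite normrM normfV (ger0_norm t_ge0).
  have [->|t0] := eqVneq t 0; last by rewrite ler_pdivrMl // lt0r t0.
  by rewrite invr0 !mul0r.
have tB : (t * t^-1) *: B = B.
  have [t0|t0] := eqVneq t 0; last by rewrite divff ?scale1r.
  suff -> : B = 0 by rewrite scaler0.
  have ImX0 u : 'Im (quad X u) = 0.
    by have [_] := Xt u; rewrite t0 mul0r normr_le0 => /eqP.
  apply: psd_eq0 => [|u]; last by rewrite quadB ImX0.
  by split=> // u; rewrite quadB ImX0.
exists (2^-1 *: (A + t^-1 *: B)), (2^-1 *: (A + (- t^-1) *: B)); split.
- exact: half_psd.
- by apply: half_psd => [|u]; [rewrite rmorphN /= tVJ | rewrite mulNr normrN].
have two0 : (2 : C) != 0 by rewrite pnatr_eq0.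
have -> : X = A + 'i *: B.
  apply/matrixP => i j; rewrite !mxE.
  transitivity (2^-1 * (X i j + (X j i)^*)
    + 'i ^+ 2 * (2^-1 * ((X j i)^* - X i j))); last by ring.
  by rewrite sqrCi; field.
rewrite -{1}tB; apply/matrixP => i j.
rewrite !mxE -!/(A i j) -!/(B i j).
(* With [t^-1] made opaque, [field] needs only [2 != 0], so the case [t = 0] is included. *)
move: (_ * (_ + _)) (_ * (_ - _)) (t^-1) => x y r.
by field.
Qed.

Lemma schur_sector_bound (t s a b : C) X Y u :
  0 <= t -> 0 <= s -> 0 <= b ->
  quad_in_sector t X -> quad_in_sector s Y ->
  (forall v, `|quad X v| <= a * sqnorm v) ->
  (forall v, `|quad Y v| <= b * sqnorm v) ->
  `|quad (schur_mx X Y) u|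
    <= `|1 + 'i * t| * `|1 + 'i * s| * (a * b * sqnorm u).
Proof.
move=> t0 s0 b0 /(sector_decomposition t0)[P [Q [psdP psdQ ->]]].
move=> /(sector_decomposition s0)[P' [Q' [psdP' psdQ' ->]]] Xa Yb.
have norm_conj (r : C) : 0 <= r -> `|1 - 'i * r| = `|1 + 'i * r|.
  move=> r0; rewrite -norm_conjC rmorphB rmorphM /= conjC1 conjCi.
  by rewrite (CrealP (ger0_real r0)) mulNr opprK.
(* The form of [Z + W] is the real part of that of the combination, hence at most its modulus. *)
have real_part (r c : C) Z W : 0 <= r -> psd Z -> psd W ->
    (forall v, `|quad ((1 + 'i * r) *: Z + (1 - 'i * r) *: W) v| <= c * sqnorm v) ->
    forall v, quad (Z + W) v <= c * sqnorm v.
  move=> r0 [_ Z0] [_ W0] Zc v; apply: le_trans (Zc v).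
  have -> : quad (Z + W) v
      = 'Re (quad ((1 + 'i * r) *: Z + (1 - 'i * r) *: W) v).
    rewrite !quadD !quadZ.
    have -> : (1 + 'i * r) * quad Z v + (1 - 'i * r) * quad W v
        = (quad Z v + quad W v) + 'i * (r * (quad Z v - quad W v)) by ring.
    by rewrite Re_rect // ?rpredD ?rpredM ?rpredB ?ger0_real.
  exact: (leif_Re_Creal _).1.
apply: (@le_trans _ _ (`|1 + 'i * t| * `|1 + 'i * s|
    * quad (schur_mx (P + Q) (P' + Q')) u)); last first.
  rewrite ler_wpM2l ?mulr_ge0 //.
  apply: quad_schur_le => //; first exact: psdD.
  - exact: (real_part t).
  - exact: (real_part s).
have -> : schur_mx (P + Q) (P' + Q') = schur_mx P P' + schur_mx P Q'
    + schur_mx Q P' + schur_mx Q Q'.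
  by apply/matrixP => i j; rewrite !mxE; ring.
set ct := 1 + 'i * t; set cs := 1 + 'i * s; set dt := 1 - 'i * t; set ds := 1 - 'i * s.
have -> : schur_mx (ct *: P + dt *: Q) (cs *: P' + ds *: Q')
    = (ct * cs) *: schur_mx P P' + (ct * ds) *: schur_mx P Q'
      + (dt * cs) *: schur_mx Q P' + (dt * ds) *: schur_mx Q Q'.
  by apply/matrixP => i j; rewrite !mxE; ring.
rewrite !quadD !quadZ !(mulrDr (`|ct| * `|cs|)).
have term A B c d : psd A -> psd B -> `|c| = `|ct| -> `|d| = `|cs| ->
    `|c * d * quad (schur_mx A B) u| <= `|ct| * `|cs| * quad (schur_mx A B) u.
  move=> psdA [_ B0] cE dE.
  by rewrite !normrM cE dE (ger0_norm (quad_schur_ge0 u psdA B0)).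
have dtE : `|dt| = `|ct| by exact: norm_conj.
have dsE : `|ds| = `|cs| by exact: norm_conj.
(* The triangle inequality peels off the four terms one by one. *)
do 3![apply: le_trans (ler_normD _ _) _; apply: lerD; last exact: term].
exact: term.
Qed.

End QuadraticForm.

(** * From forms to the numerical radius *)

Section NumericalRadius.
Set Implicit Arguments.
Unset Strict Implicit.
Variables (R : realType) (n : nat).
Hypothesis n_gt0 : (0 < n)%N.
Implicit Types X Y : 'M[R[i]]_n.

Lemma cdot_mulmx X (x : 'cV[R[i]]_n) :
  cdot (X *m x) x = quad X (fun i => x i 0).
Proof.
rewrite /cdot dotmxE mxE /quad; apply: eq_bigr => i _.
by rewrite !mxE big_distrl.
Qed.

Lemma cnorm_eq1 (x : 'cV[R[i]]_n) : cnorm x = 1 <-> sqnorm (fun i => x i 0) = 1.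
Proof.
have -> : sqnorm (fun i => x i 0) = cdot x x.
  by rewrite /cdot dotmxE mxE; apply: eq_bigr => i _; rewrite !mxE.
rewrite /cnorm; split=> [/(congr1 (fun z => z ^+ 2))|->]; last exact: sqrtC1.
by rewrite sqrtCK expr1n.
Qed.

Lemma numerical_rangeP X (z : R[i]) : numerical_range X z <->
  exists2 u : 'I_n -> R[i], sqnorm u = 1 & quad X u = z.
Proof.
split=> [[x /cnorm_eq1 x1 <-]|[u u1 <-]].
  by exists (fun i => x i 0); rewrite ?cdot_mulmx.
have uE : (fun i => (\col_j u j) i 0) = u by apply/funext => i; rewrite mxE.
exists (\col_j u j); first by apply/cnorm_eq1; rewrite uE.
by rewrite cdot_mulmx uE.
Qed.

(** Entries of a unit vector have modulus at most one, so the sum of the moduli of the entries of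
    [X] is a bound. This makes [sup] an actual upper bound. *)
Lemma has_ubound_numerical_range X :
  has_ubound [set cmod z | z in numerical_range X].
Proof.
exists (\sum_i \sum_j cmod (X i j)) => _ [_ /numerical_rangeP[u u1 <-] <-].
(* The norm of [R[i]] is convertible to the embedded [cmod], so the inequality can be proved in
   [R[i]]. *)
rewrite -lecR -[X in X <= _]/(`|quad X u|) rmorph_sum /=.
have u_le1 i : `|u i| <= 1.
  rewrite -(@expr_le1 _ 2) // normCK -u1 /sqnorm (bigD1 i) //= lerDl.
  by apply: sumr_ge0 => j _; apply: mul_conjC_ge0.
apply: le_trans (ler_norm_sum _ _ _) _; apply: ler_sum => i _.
rewrite rmorph_sum /=.
apply: le_trans (ler_norm_sum _ _ _) _; apply: ler_sum => j _.
rewrite !normrM norm_conjC -mulrA -[leRHS]mulr1 ler_wpM2l //.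
by rewrite mulr_ile1.
Qed.

Lemma quad_le_radius X u : `|quad X u| <= (numerical_radius X)%:C%C * sqnorm u.
Proof.
have [v v1 uv] := unit_rescaling (Ordinal n_gt0) u.
rewrite uv normrM (ger0_norm (sqnorm_ge0 u)) mulrC ler_wpM2r ?sqnorm_ge0 //.
rewrite -[leLHS]/((cmod (quad X v))%:C%C) lecR.
apply: ub_le_sup; first exact: has_ubound_numerical_range.
by exists (quad X v) => //; apply/numerical_rangeP; exists v.
Qed.

Lemma numerical_radius_le X (r : R) :
  (forall u, `|quad X u| <= r%:C%C * sqnorm u) -> numerical_radius X <= r.
Proof.
move=> Xr; apply: ge_sup.
  (* [ge_sup] requires a nonempty set; a basis vector provides a point. *)
  have d1 := sqnorm_delta R[i] (Ordinal n_gt0).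
  by eexists; eexists; [apply/numerical_rangeP; eexists; [exact: d1|]|].
move=> _ [_ /numerical_rangeP[u u1 <-] <-].
by have := Xr u; rewrite u1 mulr1 -[leLHS]/((cmod (quad X u))%:C%C) lecR.
Qed.

Lemma numerical_radius_ge0 X : 0 <= numerical_radius X.
Proof.
have := quad_le_radius X (fun k => (k == Ordinal n_gt0)%:R).
by rewrite sqnorm_delta mulr1 => /(le_trans (normr_ge0 _)); rewrite ler0c.
Qed.

(** Rescaling extends the sector condition from unit vectors to all vectors; the strict inequality
    on the real part becomes weak, as zero is now included. *)
Lemma sectorial_quad alpha X : sectorial alpha X ->
  exists2 z : R[i], `|z| = 1 & quad_in_sector (tan alpha)%:C%C (z *: X).
Proof.
move=> [z z1 Xz]; exists z; first by rewrite -[LHS]/((cmod z)%:C%C) z1.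
move=> u; have [v v1 uv] := unit_rescaling (Ordinal n_gt0) u.
have /Xz[Re0 Im_le] : numerical_range (z *: X) (quad (z *: X) v).
  by apply/numerical_rangeP; exists v.
have N0 := sqnorm_ge0 u; have Nreal := ger0_real N0.
rewrite uv ReMl // ImMl // -complexRe -complexIm; split.
  by rewrite mulr_ge0 // ler0c ltW.
rewrite normrM (ger0_norm N0) mulrCA ler_wpM2l //.
by rewrite -rmorphM /= normc_def /= expr0n /= addr0 sqrtr_sqr lecR.
Qed.

End NumericalRadius.

(** This is [1 + tan^2 = cos^-2], with a positive cosine on the given range. *)
Lemma normc_1i_tan (R : realType) (alpha : R) : 0 <= alpha < pi / 2 ->
  `|1 + 'i * (tan alpha)%:C%C| = (sec alpha)%:C%C :> R[i].
Proof.
move=> /andP[a0 a1].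
have c0 : 0 < cos alpha.
  apply: cos_gt0_pihalf; rewrite a1 andbT (lt_le_trans _ a0) //.
  by rewrite oppr_lt0 divr_gt0 ?pi_gt0.
rewrite -complexiE normc_def /=; congr (_%:C)%C.
rewrite !(mul0r, mulr0, mul1r, addr0, add0r, subr0, oppr0, expr1n).
by rewrite -cos2_tan2 ?gt_eqF // -exprVn sqrtr_sqr ger0_norm // invr_ge0 ltW.
Qed.

Theorem theorem2p3 (R : realType) (n : nat) (hn : (0 < n)%N)
    (alpha1 alpha2 : R)
    (halpha1 : 0 <= alpha1 < pi / 2) (halpha2 : 0 <= alpha2 < pi / 2)
    (X Y : 'M[R[i]]_n)
    (hX : sectorial alpha1 X) (hY : sectorial alpha2 Y) :
  numerical_radius (hadamard X Y)
    <= sec alpha1 * sec alpha2 * numerical_radius X * numerical_radius Y.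
Proof.
have tan_ge0 (a : R) : 0 <= a < pi / 2 -> 0 <= (tan a)%:C%C :> R[i].
  move=> /andP[a0 a1]; rewrite ler0c divr_ge0 //.
    rewrite sin_ge0_pi // a0 (le_trans (ltW a1)) // ler_pdivrMr //.
    by rewrite ler_peMr ?pi_ge0 // ler1n.
  rewrite cos_ge0_pihalf // (ltW a1) andbT (le_trans _ a0) //.
  by rewrite oppr_le0 divr_ge0 ?pi_ge0.
have [z z1 Xz] := sectorial_quad hn hX.
have [w w1 Yw] := sectorial_quad hn hY.
apply: numerical_radius_le => // u.
(* Both rotations factor out of the product as [z * w], of modulus one. *)
have -> : `|quad (hadamard X Y) u| = `|quad (schur_mx (z *: X) (w *: Y)) u|.
  have -> : schur_mx (z *: X) (w *: Y) = (z * w) *: hadamard X Y.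
    by apply/matrixP => i j; rewrite !mxE; ring.
  by rewrite quadZ !normrM z1 w1 !mul1r.
have -> : (sec alpha1 * sec alpha2 * numerical_radius X * numerical_radius Y)%:C%C
    * sqnorm u = `|1 + 'i * (tan alpha1)%:C%C| * `|1 + 'i * (tan alpha2)%:C%C|
      * ((numerical_radius X)%:C%C * (numerical_radius Y)%:C%C * sqnorm u).
  by rewrite (normc_1i_tan halpha1) (normc_1i_tan halpha2) !rmorphM /= !mulrA.
apply: schur_sector_bound => // [|||v|v].
- exact: tan_ge0.
- exact: tan_ge0.
- by rewrite ler0c numerical_radius_ge0.
- by rewrite quadZ normrM z1 mul1r quad_le_radius.
- by rewrite quadZ normrM w1 mul1r quad_le_radius.
Qed.
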